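(* If a Banach space $E$ has the Banach-Saks property and the weak Dunford-Pettis property, then $E$ is finite dimensional.
   Context: A subset $A$ of a Banach space $E$ is a Banach-Saks set if every sequence in $A$ has a subsequence whose arithmetic means converge in norm. $E$ has the Banach-Saks property if every bounded subset of $E$ is a Banach-Saks set. A sequence $(x_n)$ in a Banach space $E$ is uniformly weakly null if for each $\epsilon>0$ there is $N(\epsilon)\in\mathbb{N}$ such that $\operatorname{card}\{n\in\mathbb{N}: |\phi(x_n)|\ge\epsilon\}\le N(\epsilon)$ for every $\phi\in E^*$ with $\|\phi\|\le1$. A Banach space $E$ has the weak Dunford-Pettis property if, whenever $(x_n)\subset E$ is uniformly weakly null and $(\phi_n)\subset E^*$ is weakly null, $\lim_n\phi_n(x_n)=0$. *)

(* Defs.v *)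
From HB Require Import structures.
From mathcomp Require Import all_boot all_order all_algebra complex.
From mathcomp Require Import all_classical all_reals all_analysis.

Set Implicit Arguments.
Unset Strict Implicit.
Unset Printing Implicit Defensive.

Import Order.TTheory GRing.Theory Num.Theory.
Import numFieldNormedType.Exports.

Local Open Scope classical_set_scope.
Local Open Scope card_scope.
Local Open Scope ring_scope.

(* All notions are defined over an arbitrary K : numFieldType; they are used
   for K = R and K = R[i], with R : realType.  Over R[i] norms take values in
   R[i], and [0 < e] forces e to be a positive real. *)

Definition continuous_functional (K : numFieldType) (E : normedModType K) :
  {pred E -> K^o} := fun f => `[< linear f /\ continuous f >].

Fact continuous_functional_submod_closed (K : numFieldType)
  (E : normedModType K) : submod_closed (@continuous_functional K E).
Proof.
split=> [|a f g /asboolP[lf cf] /asboolP[lg cg]]; apply/asboolP; split.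
- by move=> a x y; rewrite [LHS](_ : _ = 0) ?[RHS](_ : _ = a *: 0 + 0)
    ?scaler0 ?addr0.
- by move=> x; exact: cvg_cst.
- move=> b x y.
  change (a *: f (b *: x + y) + g (b *: x + y)
    = b *: (a *: f x + g x) + (a *: f y + g y)).
  by rewrite lf lg !scalerDr !scalerA (mulrC a b) addrACA.
- move=> x; apply: (@cvgD _ _ _ _ _ (a \*: f) g); last exact: cg.
  by apply: cvgZr; exact: cf.
Qed.

HB.instance Definition _ (K : numFieldType) (E : normedModType K) :=
  GRing.isSubmodClosed.Build K (E -> K^o) (@continuous_functional K E)
    (@continuous_functional_submod_closed K E).

(* The topological dual E^*, with pointwise operations. *)
Record dual (K : numFieldType) (E : normedModType K) := Dual {
  dual_fun :> E -> K^o;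
  _ : dual_fun \in @continuous_functional K E }.

HB.instance Definition _ (K : numFieldType) (E : normedModType K) :=
  [isSub for @dual_fun K E].
HB.instance Definition _ (K : numFieldType) (E : normedModType K) :=
  [Choice of dual E by <:].
HB.instance Definition _ (K : numFieldType) (E : normedModType K) :=
  [SubChoice_isSubLmodule of dual E by <:].

(* ||phi|| <= c, where ||phi|| is the supremum of |phi x| over ||x|| <= 1;
   stated without the supremum since K may be R[i]. *)
Definition dual_norm_le (K : numFieldType) (E : normedModType K)
  (phi : dual E) (c : K) : Prop := forall x : E, `|x| <= 1 -> `|phi x| <= c.

(* A linear functional on E^* belongs to the bidual E^** when it is bounded on
   the unit ball of E^*. *)
Definition in_bidual (K : numFieldType) (E : normedModType K)
  (F : {linear dual E -> K^o}) : Prop :=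
  exists M : K, forall phi : dual E, dual_norm_le phi 1 -> `|F phi| <= M.

Definition dual_weakly_null (K : numFieldType) (E : normedModType K)
  (phi : nat -> dual E) : Prop :=
  forall F : {linear dual E -> K^o}, in_bidual F ->
    F (phi n) @[n --> \oo] --> (0 : K^o).

Definition uniformly_weakly_null (K : numFieldType) (E : normedModType K)
  (x : nat -> E) : Prop :=
  forall e : K, 0 < e -> exists N : nat,
    forall phi : dual E, dual_norm_le phi 1 ->
      [set n | e <= `|phi (x n)|] #<= `I_N.

Definition weak_Dunford_Pettis (K : numFieldType) (E : normedModType K) :
  Prop :=
  forall (x : nat -> E) (phi : nat -> dual E),
    uniformly_weakly_null x -> dual_weakly_null phi ->
    phi n (x n) @[n --> \oo] --> (0 : K^o).

Definition Banach_Saks_set (K : numFieldType) (E : normedModType K)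
  (A : set E) : Prop :=
  forall x : nat -> E, (forall n, A (x n)) ->
    exists k : nat -> nat, {homo k : m n / (m < n)%N} /\
      exists l : E,
        n.+1%:R^-1 *: (\sum_(i < n.+1) x (k i)) @[n --> \oo] --> l.

Definition Banach_Saks_property (K : numFieldType) (E : normedModType K) :
  Prop :=
  forall A : set E, bounded_set A -> Banach_Saks_set A.

Definition finite_dimensional (K : fieldType) (E : lmodType K) : Prop :=
  exists (n : nat) (b : 'I_n -> E),
    forall x : E, exists a : 'I_n -> K, x = \sum_(i < n) a i *: b i.

(* Main.v *)
(* A nonzero functional can be made to vanish on any finite subset of an
   infinite-dimensional E, so one builds inductively functionals [psi n] of norm
   at most 1 and an increasing sequence of finite subsets [S n] of the unit ball
   such that [psi n] vanishes on [S n], is at least 1/2 at some point [x n] of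
   the ball, and [S n] norms the span of the preceding functionals up to a
   constant independent of n.  The Banach-Saks property then makes [psi] weakly
   null.  It also makes some subsequence of [x], minus a point of E, uniformly
   weakly null: by a Ramsey argument the difference of the means of two
   consecutive blocks is either small for all long blocks or large for all of
   them, and the latter is incompatible with convergent arithmetic means.  This
   contradicts the weak Dunford-Pettis property.

   The real and the complex case are treated together over a field of scalars
   with an Archimedean norm, a precompact unit disc, and the Hahn-Banach
   extension property. *)

Require Import Defs.
From HB Require Import structures.
From mathcomp Require Import all_boot all_order all_algebra finmap complex.
From mathcomp Require Import all_classical all_reals all_analysis.
From mathcomp Require Import ring lra.

Import Order.TTheory GRing.Theory Num.Theory.
Import numFieldNormedType.Exports.

Local Open Scope classical_set_scope.
Local Open Scope ring_scope.

Set Implicit Arguments.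
Unset Strict Implicit.
Unset Printing Implicit Defensive.

(** * Hahn-Banach extension *)

Lemma linear_bundle (K : pzRingType) (U V : lmodType K) (f : U -> V) :
  linear f -> exists g : {linear U -> V}, g = f :> (U -> V).
Proof.
move=> flin; pose fM := GRing.isLinear.Build K U V *:%R f flin.
pose g : {linear U -> V} := HB.pack_for {linear U -> V} f fM.
by exists g.
Qed.

Definition scaler_line (K : nzRingType) (V : lmodType K) (v : V) : K^o -> V :=
  fun a => a *: v.

Fact scaler_line_linear (K : nzRingType) (V : lmodType K) (v : V) :
  linear (scaler_line v).
Proof. by move=> a b c; rewrite /scaler_line scalerDl scalerA. Qed.

HB.instance Definition _ (K : nzRingType) (V : lmodType K) (v : V) :=
  GRing.isLinear.Build K K^o V *:%R (scaler_line v) (scaler_line_linear v).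

Definition sublinear (R : realType) (V : lmodType R) (p : V -> R) : Prop :=
  (forall x y, p (x + y) <= p x + p y) /\
  (forall t x, 0 <= t -> p (t *: x) = t * p x).

Lemma sublinear0 (R : realType) (V : lmodType R) (p : V -> R) :
  sublinear p -> p 0 = 0.
Proof. by move=> [_ pZ]; rewrite -(scale0r 0) pZ// mul0r. Qed.

Section infimal_extension.
Variables (R : realType) (U V : lmodType R) (T : {linear U -> V}).
Variables (f : {linear U -> R^o}) (p : V -> R).
Hypotheses (psub : sublinear p) (fp : forall u, f u <= p (T u)).

(** A linear functional lies below this one exactly when it lies below [p] and agrees with [f] along
    [T]. *)
Definition infimal_extension (x : V) : R :=
  inf (range (fun u => p (x + T u) - f u)).

Let lbound x u : - p (- x) <= p (x + T u) - f u.
Proof.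
have := fp u; have /= := psub.1 (x + T u) (- x).
rewrite addrAC subrr add0r; lra.
Qed.

Let has_inf_range x : has_inf (range (fun u => p (x + T u) - f u)).
Proof.
split; first by exists (p (x + T 0) - f 0); exists 0.
by exists (- p (- x)) => _ [u _ <-]; exact: lbound.
Qed.

Lemma infimal_extension_le x u : infimal_extension x <= p (x + T u) - f u.
Proof. by apply: ge_inf; [exact: (has_inf_range x).2|exists u]. Qed.

Lemma le_infimal_extension x c :
  (forall u, c <= p (x + T u) - f u) -> c <= infimal_extension x.
Proof.
move=> cle; apply: lb_le_inf; first exact: (has_inf_range x).1.
by move=> _ [u _ <-].
Qed.

Lemma infimal_extension_sublinear : sublinear infimal_extension.
Proof.
have posZ t x : 0 < t -> infimal_extension (t *: x) = t * infimal_extension x.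
  (* One inequality suffices: used for [t], and for [t^-1] at [t *: x], it gives equality. *)
  have half s y : 0 < s ->
      s * infimal_extension y <= infimal_extension (s *: y).
    move=> s0; apply: le_infimal_extension => u.
    have -> : p (s *: y + T u) - f u =
              s * (p (y + T (s^-1 *: u)) - f (s^-1 *: u)).
      rewrite mulrBr -psub.2 ?(ltW s0)// scalerDr -linearZ scalerA.
      rewrite mulfV ?gt_eqF// scale1r [f (_ *: _)]linearZ/= /GRing.scale/=.
      by rewrite mulrA mulfV ?gt_eqF// mul1r.
    by rewrite ler_pM2l// infimal_extension_le.
  move=> t0; apply/eqP; rewrite eq_le half// andbT.
  have := half t^-1 (t *: x); rewrite invr_gt0 scalerA mulVf ?gt_eqF// scale1r.
  by move=> /(_ t0); rewrite ler_pdivrMl.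
split=> [x y|t x].
  rewrite -lerBlDr; apply: le_infimal_extension => u.
  rewrite lerBlDr -lerBlDl; apply: le_infimal_extension => v.
  rewrite lerBlDl (le_trans (infimal_extension_le _ (u + v)))//.
  rewrite !linearD/= addrACA; have := psub.1 (x + T u) (y + T v); lra.
rewrite le_eqVlt => /predU1P[<-|]; last exact: posZ.
(* Homogeneity under the factor 2 forces the value at 0 to be 0. *)
rewrite scale0r mul0r; have := posZ 2 0; rewrite scaler0; lra.
Qed.

End infimal_extension.

Section real_Hahn_Banach.
Variables (R : realType) (V : lmodType R).

(* By minimality, the infimal extension of [a |-> a * p y] along [a |-> a *: y]
   is [p] itself. *)
Lemma minimal_sublinear_linear (p : V -> R) : sublinear p ->
  (forall q, sublinear q -> (forall x, q x <= p x) -> q = p) ->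
  forall a x y, p (a *: x + y) = a * p x + p y.
Proof.
move=> psub pmin.
have ppN x : 0 <= p x + p (- x).
  by rewrite (le_trans _ (psub.1 _ _))// subrr sublinear0.
have pD x y : p (x + y) = p x + p y.
  apply/eqP; rewrite eq_le psub.1/=.
  pose T : {linear R^o -> V} := scaler_line y.
  pose f : {linear R^o -> R^o} := scaler_line (p y : R^o).
  (* For [u < 0] this is [0 <= p y + p (- y)] multiplied by [- u]. *)
  have fT u : f u <= p (T u).
    rewrite /f /T /= /scaler_line {1}/GRing.scale/=; have [u0|u0] := leP 0 u.
      by rewrite psub.2.
    rewrite -[u *: y]opprK -scalerN -scaleNr psub.2 ?oppr_ge0 ?(ltW u0)//.
    rewrite -subr_ge0 addrC -mulNr -mulrDr mulr_ge0//.
    by rewrite oppr_ge0 ltW.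
  have := pmin (infimal_extension T f p)
    (infimal_extension_sublinear psub fT).
  have qle := infimal_extension_le psub fT.
  move=> /(_ (fun z => le_trans (qle z 0) _)) qp.
  have := qle x 1; rewrite qp; last first.
    by move=> z; rewrite /T /f /= /scaler_line !scale0r subr0 addr0.
  by rewrite /f /T/= /scaler_line !scale1r lerBrDr.
have pN x : p (- x) = - p x.
  by apply/eqP; rewrite -addr_eq0 -pD addNr sublinear0.
move=> a x y; rewrite pD; congr (_ + _).
have [a0|a0] := leP 0 a; first by rewrite psub.2.
by rewrite -[a]opprK scaleNr pN psub.2 ?oppr_ge0 ?(ltW a0)// !mulNr.
Qed.

(** Zorn's lemma on the sublinear functionals below [q]: a chain has its pointwise infimum as a
    lower bound, finite because every member is at least [- q (- v)] at [v], and a minimal element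
    is linear. *)
Lemma sublinear_minorant (q : V -> R) : sublinear q ->
  exists g : {linear V -> R^o}, forall v, g v <= q v.
Proof.
move=> qsub.
pose X := {p : V -> R | sublinear p /\ forall v, p v <= q v}.
(* The order is reversed, so that maximality for [rel] is minimality of the functional. *)
pose rel (s t : X) := `[< forall v, sval t v <= sval s v >].
have [||||[p [psub pq]] pmin] := @Zorn X rel.
- by move=> t; apply/asboolP.
- move=> r s t /asboolP rs /asboolP st; apply/asboolP => v.
  exact: le_trans (rs v).
- move=> [s Ps] [t Pt] /asboolP/= st /asboolP/= ts; apply: eq_exist => /=.
  by apply/funext => v; apply/eqP; rewrite eq_le ts st.
- move=> A Atot; have [[a Aa]|A0] := pselect (A !=set0); last first.
    have qP : sublinear q /\ forall v, q v <= q v by split.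
    by exists (exist _ q qP) => s As; exfalso; apply: A0; exists s.
  pose m v := inf [set sval s v | s in A].
  have mlb v : has_inf [set sval s v | s in A].
    split; first by exists (sval a v); exists a.
    exists (- q (- v)) => _ [[s [ssub sq]]/= As <-].
    have := ssub.1 v (- v); rewrite subrr sublinear0// => h.
    by rewrite lerNl (le_trans _ (sq _))//; lra.
  have mle s v : A s -> m v <= sval s v.
    by move=> As; apply: ge_inf; [exact: (mlb v).2|exists s].
  have infm_ge (v : V) (c : R) : (forall s, A s -> c <= sval s v) -> c <= m v.
    move=> h; apply: lb_le_inf; first exact: (mlb v).1.
    by move=> _ [s As <-]; exact: h.
  have msub : sublinear m.
    have posZ t x : 0 < t -> t * m x <= m (t *: x).
      move=> t0; apply: (infm_ge) => s As; have [ssub _] := svalP s.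
      by rewrite ssub.2 ?(ltW t0)// ler_pM2l// mle.
    split=> [x y|t x].
      rewrite -lerBlDr; apply: (infm_ge) => s As.
      rewrite lerBlDr -lerBlDl; apply: infm_ge => t At.
      rewrite lerBlDl; have [ssub _] := svalP s; have [tsub _] := svalP t.
      (* The smaller of [s] and [t] serves for both [x] and [y]. *)
      have [/asboolP st|/asboolP ts] := Atot _ _ As At.
        rewrite (le_trans (mle _ _ At))// (le_trans (tsub.1 _ _))//.
        by rewrite lerD2r.
      rewrite (le_trans (mle _ _ As))// (le_trans (ssub.1 _ _))//.
      by rewrite lerD2l.
    rewrite le_eqVlt => /predU1P[<-|t0].
      rewrite scale0r mul0r; apply/eqP; rewrite eq_le; apply/andP; split.
        rewrite (le_trans (mle _ _ Aa))//; have [asub _] := svalP a.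
        by rewrite sublinear0.
      by apply: (infm_ge) => s As; have [ssub _] := svalP s; rewrite sublinear0.
    apply/eqP; rewrite eq_le posZ// andbT.
    have := posZ t^-1 (t *: x); rewrite invr_gt0 scalerA mulVf ?gt_eqF//.
    by rewrite scale1r => /(_ t0); rewrite ler_pdivrMl.
  have mP : sublinear m /\ forall v, m v <= q v.
    split=> // v; rewrite (le_trans (mle _ _ Aa))//.
    by have [_] := svalP a; exact.
  by exists (exist _ m mP) => s As; apply/asboolP => v /=; exact: mle.
have plin : linear (p : V -> R^o).
  apply: minimal_sublinear_linear => // r rsub rp.
  have rP : sublinear r /\ forall v, r v <= q v.
    by split=> // v; exact: le_trans (pq v).
  have := pmin (exist _ r rP); rewrite /rel /= => /(_ _)/(congr1 sval)/= -> //.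
  exact/asboolP.
by have [g gp] := linear_bundle plin; exists g; rewrite gp.
Qed.

Lemma real_Hahn_Banach (U : lmodType R) (T : {linear U -> V})
    (f : {linear U -> R^o}) (p : V -> R) :
  sublinear p -> (forall u, f u <= p (T u)) ->
  exists g : {linear V -> R^o},
    (forall v, g v <= p v) /\ (forall u, g (T u) = f u).
Proof.
move=> psub fp.
have [g gq] := sublinear_minorant
  (infimal_extension_sublinear psub fp).
have qle := infimal_extension_le psub fp.
exists g; split=> [v|u].
  rewrite (le_trans (gq v))// (le_trans (qle v 0))//.
  by rewrite [T 0]linear0 [f 0]linear0 addr0 subr0.
(* Taking [- w] in the infimum at [T w] leaves [p 0 - f (- w)]; the same bound at [- u] then gives
   the reverse inequality. *)
have gle w : g (T w) <= f w.
  rewrite (le_trans (gq _))// (le_trans (qle _ (- w)))// [T (- w)]linearN subrr.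
  by rewrite sublinear0// [f (- w)]linearN opprK add0r.
apply/eqP; rewrite eq_le gle/=.
by have := gle (- u); rewrite !linearN lerN2.
Qed.

End real_Hahn_Banach.

(* The subspace on which [f] is given is the range of [T], which spares
   partially defined functionals. *)
Definition Hahn_Banach_field (K : numFieldType) : Prop :=
  forall (U V : lmodType K) (T : {linear U -> V}) (f : {linear U -> K^o})
    (p : V -> K),
    (forall x y, p (x + y) <= p x + p y) ->
    (forall a x, p (a *: x) = `|a| * p x) ->
    (forall u, `|f u| <= p (T u)) ->
  exists g : {linear V -> K^o},
    (forall v, `|g v| <= p v) /\ (forall u, g (T u) = f u).

Lemma Hahn_Banach_real (R : realType) : Hahn_Banach_field R.
Proof.
move=> U V T f p pD pZ fp.
have psub : sublinear p by split=> // t x t0; rewrite pZ ger0_norm.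
have [u|g [gp gT]] := @real_Hahn_Banach _ _ _ T f _ psub.
  by rewrite (le_trans (ler_norm _)).
exists g; split=> // v; rewrite ler_norml gp andbT lerNl -linearN.
by rewrite (le_trans (gp _))// -scaleN1r pZ normrN1 mul1r.
Qed.

(** * Complex scalars by restriction to the reals *)

Section realification.
Local Open Scope complex_scope.
Variable R : realType.

(** A separate name for the same type keeps the action of [R] apart from that of [R[i]]. *)
Definition realified (V : lmodType R[i]) : Type := V.

HB.instance Definition _ (V : lmodType R[i]) := GRing.Zmodule.on (realified V).

Definition realified_scale (V : lmodType R[i]) (a : R) (v : realified V) :
  realified V := (a%:C *: (v : V) : V).

Fact realified_scaleA (V : lmodType R[i]) a b (v : realified V) :
  realified_scale a (realified_scale b v) = realified_scale (a * b) v.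
Proof. by rewrite /realified_scale scalerA rmorphM. Qed.

Fact realified_scale1 (V : lmodType R[i]) :
  left_id 1 (@realified_scale V).
Proof. by move=> v; rewrite /realified_scale rmorph1 scale1r. Qed.

Fact realified_scaleDr (V : lmodType R[i]) :
  right_distributive (@realified_scale V) +%R.
Proof. by move=> a v w; rewrite /realified_scale scalerDr. Qed.

Fact realified_scaleDl (V : lmodType R[i]) (v : realified V) :
  {morph (@realified_scale V)^~ v : a b / a + b}.
Proof. by move=> a b; rewrite /realified_scale rmorphD scalerDl. Qed.

HB.instance Definition _ (V : lmodType R[i]) :=
  GRing.Zmodule_isLmodule.Build R (realified V)
    (@realified_scaleA V) (@realified_scale1 V) (@realified_scaleDr V)
    (@realified_scaleDl V).

Lemma realified_scaleE (V : lmodType R[i]) (a : R) (v : realified V) :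
  a *: v = (a%:C *: (v : V) : V).
Proof. by []. Qed.

(** Rotation turns a modulus into a real part, so that a bound on the real part of a complex
    functional bounds its modulus. *)
Lemma normc_ReP (z : R[i]) :
  exists2 c : R[i], `|c| = 1 & complex.Re (c * z) = complex.Re `|z|.
Proof.
have [->|z0] := eqVneq z 0.
  by exists 1; rewrite ?normr1// mulr0 normr0.
exists (`|z| / z); last by rewrite divfK.
by rewrite normrM normr_id normfV mulfV// normr_eq0.
Qed.

(* [g] plays the role of the real part: [Im (G v) = - Re (G (i v))]. *)
Lemma complex_linear_of_Re (V : lmodType R[i])
    (g : {linear realified V -> R^o}) :
  linear (fun v : V => (g (v : realified V) -i* g ('i *: v : V)) : (R[i])^o).
Proof.
move=> [a b] x y.
have gZ (c d : R) (v : V) :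
    g ((c +i* d) *: v : V) = c * g v + d * g ('i *: v : V).
  have -> : (c +i* d) *: v = c%:C *: v + d%:C *: ('i *: v).
    rewrite scalerA -scalerDl; congr (_ *: _).
    by apply/eqP; rewrite eq_complex /=; apply/andP; split; apply/eqP; ring.
  by rewrite -[c%:C *: v]realified_scaleE -[d%:C *: _]realified_scaleE
     linearD !linearZ.
rewrite scalerDr scalerA; apply/eqP; rewrite eq_complex.
have -> : 'i * (a +i* b) = (- b) +i* a :> R[i].
  by apply/eqP; rewrite eq_complex /=; apply/andP; split; apply/eqP; ring.
have gD (v w : V) : g (v + w : V) = g v + g w by exact: linearD.
rewrite !gD (gZ a b x) (gZ (- b) a x) /=; apply/andP; split; apply/eqP; ring.
Qed.

(** The real part of [f] is extended over the realified spaces, below the real part of [p], and the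
    complex functional is rebuilt from this extension. *)
Lemma Hahn_Banach_complex : Hahn_Banach_field R[i].
Proof.
move=> U V T f p pD pZ fp.
have p_ge0 v : 0 <= p v.
  have := pD v (- v); rewrite subrr -{1}(scale0r v) -scaleN1r !pZ.
  by rewrite normr0 mul0r normrN1 mul1r -mulr2n pmulrn_lge0.
have pE v : p v = (complex.Re (p v))%:C.
  have := p_ge0 v; rewrite lecE => /andP[/eqP p0 _].
  by apply/eqP; rewrite eq_complex p0 !eqxx.
have Re_le (z w : R[i]) : z <= w -> complex.Re z <= complex.Re w.
  by rewrite lecE => /andP[].
have ReZ (t : R) (z : R[i]) : complex.Re (t%:C * z) = t * complex.Re z.
  by case: z => a b /=; rewrite mul0r subr0.
have ReD (z w : R[i]) : complex.Re (z + w) = complex.Re z + complex.Re w.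
  by case: z w => [a b] [c d].
pose P (v : realified V) : R := complex.Re (p v).
have Psub : sublinear P.
  split=> [x y|t x t0].
    by have := Re_le _ _ (pD x y); rewrite ReD.
  rewrite /P realified_scaleE pZ ger0_norm ?ler0c//; exact: ReZ.
pose f1 (u : realified U) : R^o := complex.Re (f u).
have f1lin : linear f1.
  move=> a x y; rewrite /f1 realified_scaleE linearD ReD.
  by rewrite linearZ /= {1}/GRing.scale/= ReZ.
have [f' f'E] := linear_bundle f1lin.
pose T1 (u : realified U) : realified V := T u.
have T1lin : linear T1.
  by move=> a x y; rewrite /T1 realified_scaleE linearD linearZ.
have [T' T'E] := linear_bundle T1lin.
have f'le u : f' u <= P (T' u).
  rewrite f'E T'E /f1 /P /T1; apply: le_trans (Re_le _ _ (fp u)).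
  rewrite normc_def /= (le_trans (ler_norm _))//.
  by rewrite -sqrtr_sqr ler_wsqrtr// lerDl sqr_ge0.
have [g [gP gT]] := real_Hahn_Banach Psub f'le.
have [G GE] := linear_bundle (complex_linear_of_Re g).
have ReG v : complex.Re (G v) = g v by rewrite GE.
exists G; split=> [v|u].
  have [c c1 cG] := normc_ReP (G v).
  have -> : `|G v| = (complex.Re `|G v|)%:C.
    have := normr_ge0 (G v); rewrite lecE => /andP[/eqP p0 _].
    by apply/eqP; rewrite eq_complex p0 !eqxx.
  rewrite -cG pE lecR -[c * G v]/((c : R[i]) *: (G v : (R[i])^o)) -linearZ ReG.
  by rewrite (le_trans (gP _))// /P pZ c1 mul1r.
have gf w : g (T w : V) = complex.Re (f w).
  by have := gT w; rewrite T'E f'E.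
rewrite GE gf -linearZ gf linearZ; case: (f u) => a b.
by apply/eqP; rewrite eq_complex /=; apply/andP; split; apply/eqP; ring.
Qed.

End realification.

(** * A diagonal Ramsey theorem *)

Section diagonal_Ramsey.
Variable F : set_system nat.
Hypothesis F_ultra : UltraFilter F.
Hypothesis F_free : forall n, F [set m | (n < m)%N].

(** The [d]-fold tensor power of [F], written as iterated quantifiers: for [F]-almost all [n1], for
    [F]-almost all [n2], and so on, [Q [:: n1; n2; ...]]. *)
Fixpoint iterated_along (d : nat) (Q : seq nat -> Prop) : Prop :=
  if d is d'.+1 then F [set n | iterated_along d' (fun s => Q (n :: s))]
  else Q [::].

Lemma iterated_along_dichotomy d (Q : seq nat -> Prop) :
  iterated_along d Q \/ iterated_along d (fun s => ~ Q s).
Proof.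
elim: d Q => [|d IH] Q /=; first exact: lem.
have [FA|FA] :=
  in_ultra_setVsetC [set n | iterated_along d (fun s => Q (n :: s))] F_ultra.
  by left.
by right; apply: filterS FA => n /= nA; have [|] := IH (fun s => Q (n :: s)).
Qed.

Lemma filter_all_seq (T : eqType) (s : seq T) (A : T -> set nat) :
  (forall x, x \in s -> F (A x)) -> F [set n | forall x, x \in s -> A x n].
Proof.
elim: s => [|x s IH] FA; first by apply: filterE => n y; rewrite in_nil.
have FAx := FA x (mem_head x s).
have FAs := IH (fun y ys => FA y (@mem_behead _ (x :: s) y ys)).
apply: filterS (filterI FAx FAs) => n [Axn Asn] y.
by rewrite inE => /predU1P[->//|]; exact: Asn.
Qed.

(** A new term meets finitely many constraints, one for each sublist of the terms chosen so far and
    each colour whose entries are at most their number; finitely many sets of [F] have a common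
    point. *)
Lemma greedy_subsequence (G : nat * nat -> seq nat -> Prop) :
  (forall k, G k [::]) ->
  (forall k s, G k s -> F [set n | G k (rcons s n)]) ->
  exists m : nat -> nat, {homo m : i j / (i < j)%N} /\
    forall (k : nat * nat) s, sorted ltn s -> all (leq k.1) s ->
      all (leq k.2) s -> G k (map m s).
Proof.
move=> G0 GS.
have next (L : seq nat) : exists n, (forall a, a \in L -> (a < n)%N) /\
    forall k s, (k.1 <= size L)%N -> (k.2 <= size L)%N -> subseq s L ->
      G k s -> G k (rcons s n).
  pose ks := allpairs pair (iota 0 (size L).+1) (iota 0 (size L).+1).
  pose masks :=
    [seq mask (b : (size L).-tuple bool) L | b : (size L).-tuple bool].
  have F1 : F [set n | forall a, a \in L -> (a < n)%N].
    exact: (@filter_all_seq _ L (fun a => [set n | (a < n)%N])).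
  have F2 : F [set n | forall k, k \in ks -> forall s, s \in masks ->
                 G k s -> G k (rcons s n)].
    apply: (@filter_all_seq _ ks (fun k => [set n | forall s, s \in masks ->
      G k s -> G k (rcons s n)])) => k _.
    apply: (@filter_all_seq _ masks (fun s =>
      [set n | G k s -> G k (rcons s n)])) => s _.
    have [Gks|nG] := pselect (G k s); last by apply: filterE => n /nG.
    by apply: filterS (GS _ _ Gks) => n Gn _.
  have [n [n1 n2]] := filter_ex (filterI F1 F2).
  exists n; split=> // k s k1 k2 /subseqP[b /eqP sb ->].
  apply: n2; last by apply/mapP; exists (Tuple sb) => //; rewrite mem_enum.
  by case: k k1 k2 => k1 k2 /= le1 le2; apply: allpairs_f; rewrite mem_iota.
have [nx nxP] := choice next.
pose L r := iter r (fun L => rcons L (nx L)) [::].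
pose m r := nx (L r).
have LE r : L r = map m (iota 0 r).
  by elim: r => // r IH; rewrite -{2}addn1 iotaD map_cat -IH /= cats1 add0n.
have sL r : size (L r) = r by rewrite LE size_map size_iota.
have mlt i j : (i < j)%N -> (m i < m j)%N.
  move=> ij; apply: (nxP (L j)).1; rewrite LE; apply: map_f.
  by rewrite mem_iota.
exists m; split=> // k; elim/last_ind => [|s r IH] ss k1 k2; first exact: G0.
move: k1 k2; rewrite !all_rcons => /andP[k1r k1s] /andP[k2r k2s].
move: ss; rewrite !(sorted_pairwise ltn_trans) pairwise_rcons => /andP[sltr ss].
have sr : subseq s (iota 0 r).
  rewrite (_ : s = [seq i <- iota 0 r | i \in s]) ?filter_subseq//.
  apply: (irr_sorted_eq ltn_trans ltnn).
  - by rewrite (sorted_pairwise ltn_trans).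
  - by apply: sorted_filter; [exact: ltn_trans|exact: iota_ltn_sorted].
  - move=> i; rewrite mem_filter mem_iota add0n /=.
    by case: (boolP (i \in s)) => //= /(allP sltr) ->.
(* The last index [r] is also the size of [L r], so [k.1 <= r] and [k.2 <= r] are the bounds
   required. *)
rewrite map_rcons; apply: (nxP (L r)).2; rewrite ?sL//.
  by rewrite LE map_subseq.
by apply: IH => //; rewrite (sorted_pairwise ltn_trans).
Qed.

Lemma Ramsey_along (d : nat * nat -> nat) (Q : nat * nat -> seq nat -> Prop) :
  exists2 m : nat -> nat, {homo m : i j / (i < j)%N} &
    exists b : nat * nat -> Prop, forall (k : nat * nat) s,
      sorted ltn s -> all (leq k.1) s -> all (leq k.2) s -> size s = d k ->
      (Q k (map m s) <-> b k).
Proof.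
have dich k : exists b : Prop, iterated_along (d k) (fun s => Q k s <-> b).
  have mono e (P P' : seq nat -> Prop) : (forall s, P s -> P' s) ->
      iterated_along e P -> iterated_along e P'.
    elim: e P P' => [|e IH] P P' PP' /=; first exact: PP'.
    by apply: filterS => n; apply: IH => s; exact: PP'.
  have [h|h] := iterated_along_dichotomy (d k) (Q k).
    by exists True; apply: mono h.
  by exists False; apply: mono h => s nQ; split.
have [b bP] := choice dich.
(* Almost every continuation of [s] to length [d k] has the polarity [b k]; at full length this is
   the desired equivalence. *)
pose G k s := (size s <= d k)%N ->
  iterated_along (d k - size s) (fun t => Q k (s ++ t) <-> b k).
have G0 k : G k [::] by move=> _; rewrite subn0; exact: bP.
have GS k s : G k s -> F [set n | G k (rcons s n)].
  move=> Gs; have [sd|ds] := ltnP (size s) (d k); last first.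
    by apply: filterE => n; rewrite /G /= size_rcons ltnNge ds.
  have := Gs (ltnW sd); rewrite -(subnSK sd) /=.
  apply: filterS => n /= h _; rewrite size_rcons.
  by under eq_fun do rewrite cat_rcons.
have [m [mlt mG]] := greedy_subsequence G0 GS.
exists m => //; exists b => k s ss k1 k2 sd.
have := mG k s ss k1 k2; rewrite /G size_map sd subnn /= cats0; exact.
Qed.

End diagonal_Ramsey.

(* The ultrafilter gives every colour a polarity; greedily choosing terms that
   respect the polarities of the colours met so far homogenizes all colours at
   once, the colour [k] only beyond index [max k.1 k.2]. *)
Lemma diagonal_Ramsey (d : nat * nat -> nat)
    (Q : nat * nat -> seq nat -> Prop) :
  exists2 m : nat -> nat, {homo m : i j / (i < j)%N} &
    exists b : nat * nat -> Prop, forall (k : nat * nat) s,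
      sorted ltn s -> all (leq k.1) s -> all (leq k.2) s -> size s = d k ->
      (Q k (map m s) <-> b k).
Proof.
have [F [F_ultra ooF]] := @ultraFilterLemma nat \oo _.
by apply: (Ramsey_along F_ultra) => n; apply: ooF; exists n.+1.
Qed.

(** * Banach-Saks sequences *)

Fact dual_linear (K : numFieldType) (E : normedModType K) (phi : dual E) :
  linear phi.
Proof. by case: phi => f /= /asboolP[]. Qed.

HB.instance Definition _ (K : numFieldType) (E : normedModType K)
  (phi : dual E) := GRing.isLinear.Build K E K^o *:%R phi (dual_linear phi).

Lemma dual_norm_leP (K : numFieldType) (E : normedModType K) (phi : dual E)
  (c : K) : dual_norm_le phi c -> forall x, `|phi x| <= c * `|x|.
Proof.
move=> phic x; have [->|x0] := eqVneq x 0.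
  by rewrite linear0 !normr0 mulr0.
have nx0 : 0 < `|x| by rewrite normr_gt0.
have /phic : `| `|x|^-1 *: x| <= 1.
  by rewrite normrZ normfV normr_id mulVf// gt_eqF.
rewrite linearZ normrZ normfV normr_id mulrC.
by rewrite ler_pdivrMr.
Qed.

Lemma cvg_dist_lt (K : numFieldType) (V : normedModType K) (u : nat -> V)
    (l : V) :
  u n @[n --> \oo] --> l <->
  (forall e, 0 < e -> exists N, forall n, (N <= n)%N -> `|l - u n| < e).
Proof.
split=> [/cvgrPdist_lt ul e /ul[N _ Nu]|ul].
  by exists N => n Nn; exact: Nu.
apply/cvgrPdist_lt => e /ul[N Nu]; exists N => // n /= Nn; exact: Nu.
Qed.

Section mean.
Variables (K : numFieldType) (V : normedModType K).
Implicit Types (z : nat -> V) (s : seq nat) (w : V) (d : K).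

Definition mean z s : V := (size s)%:R^-1 *: \sum_(i <- s) z i.

Lemma mean_subE z s w : (0 < size s)%N ->
  mean z s - w = (size s)%:R^-1 *: \sum_(i <- s) (z i - w).
Proof.
move=> s0; rewrite sumrB big_const_seq count_predT iter_addr_0.
rewrite scalerBr -[w *+ _]scaler_nat scalerA mulVf ?scale1r//.
by rewrite pnatr_eq0 -lt0n.
Qed.

Lemma mean_dist_le z s w d : (0 < size s)%N ->
  (forall i, i \in s -> `|z i - w| <= d) -> `|mean z s - w| <= d.
Proof.
move=> s0 zd; rewrite mean_subE// normrZ normfV normr_nat.
rewrite mulrC ler_pdivrMr ?ltr0n// (le_trans (ler_norm_sum _ _ _))//.
rewrite big_seq (le_trans (ler_sum _ zd))// -big_seq.
by rewrite big_const_seq count_predT iter_addr_0 mulr_natr.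
Qed.

(** The mean over a concatenation of blocks of equal length is the average of the means over the
    blocks. *)
Lemma mean_blocks_dist_le z w d (D p : nat) : (0 < D)%N ->
  (forall s, sorted ltn s -> all (leq p) s -> size s = D ->
    `|mean z s - w| <= d) ->
  forall c s, sorted ltn s -> all (leq p) s -> size s = (c.+1 * D)%N ->
    `|mean z s - w| <= d.
Proof.
move=> D0 blk c s ss ps sc; have s0 : (0 < size s)%N by rewrite sc muln_gt0 D0.
rewrite mean_subE// normrZ normfV normr_nat mulrC ler_pdivrMr ?ltr0n//.
(* With the division cleared, the induction can start from the empty list. *)
move: sc {s0}; move: c.+1 => {}c; elim: c s ss ps => [|c IH] s ss ps sc.
  by move/size0nil: sc => ->; rewrite big_nil normr0 mulr0.
have [Ds sD] : size (take D s) = D /\ size (drop D s) = (c * D)%N.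
  rewrite size_take_min size_drop sc mulSn addKn; split=> //.
  by apply/minn_idPl; exact: leq_addr.
move: ss ps; rewrite -(cat_take_drop D s) all_cat => ss /andP[ps1 ps2].
move: (ss); rewrite (sorted_pairwise ltn_trans) pairwise_cat.
move=> /and3P[_ ss1 ss2].
rewrite -!(sorted_pairwise ltn_trans) in ss1 ss2.
rewrite big_cat size_cat natrD mulrDr (le_trans (ler_normD _ _))// lerD//;
  last first.
  exact: IH.
have := blk _ ss1 ps1 Ds; rewrite mean_subE ?Ds// normrZ normfV normr_nat.
by rewrite mulrC ler_pdivrMr ?ltr0n.
Qed.

End mean.

Lemma linear_mean (K : numFieldType) (V W : normedModType K)
    (g : {linear V -> W}) (z : nat -> V) s :
  g (mean z s) = mean (g \o z) s.
Proof. by rewrite /mean linearZ raddf_sum. Qed.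

Lemma bounded_closed_ball (K : numFieldType) (V : normedModType K) (M : K) :
  0 <= M -> bounded_set [set v : V | `|v| <= M].
Proof.
move=> M0; exists M; split; first exact: ger0_real.
by move=> x Mx y /= yM; rewrite (le_trans yM)// ltW.
Qed.

Lemma homo_ltn_geq (k : nat -> nat) :
  {homo k : i j / (i < j)%N} -> forall n, (n <= k n)%N.
Proof.
by move=> kk; elim=> // n /leq_ltn_trans; apply; exact: kk.
Qed.

(* The means over the indices from [n.+1] to [2n+1] converge as well, and forget
   any given finite set of terms. *)
Lemma Banach_Saks_tails (K : numFieldType) (E : normedModType K) :
  Banach_Saks_property E -> forall (x : nat -> E) (M : K),
  (forall n, `|x n| <= M) ->
  exists k : nat -> nat, {homo k : i j / (i < j)%N} /\
    exists l : E, mean (x \o k) (iota n.+1 n.+1) @[n --> \oo] --> l.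
Proof.
move=> BS x M xM; have M0 : 0 <= M by rewrite (le_trans _ (xM 0)).
have [k [kk [l kl]]] := BS _ (@bounded_closed_ball _ E _ M0) x xM.
exists k; split=> //; exists l.
pose a n := n.+1%:R^-1 *: (\sum_(i < n.+1) x (k i)).
(* Both [2 *: a n.*2.+1] and [a n] weigh their terms by [n.+1%:R^-1], so the first [n.+1] terms
   cancel. *)
have aE n : mean (x \o k) (iota n.+1 n.+1) = 2 *: a n.*2.+1 - a n.
  rewrite /mean size_iota /a -!(big_mkord xpredT (x \o k)).
  rewrite (@big_cat_nat _ _ _ n.+1 0 n.*2.+2)//=; last first.
    by rewrite ltnS -addnn leqW ?leq_addr.
  have -> : index_iota n.+1 n.*2.+2 = iota n.+1 n.+1.
    by rewrite /index_iota -doubleS -addnn addnK.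
  rewrite scalerA -doubleS -mul2n natrM invfM mulrA mulfV ?pnatr_eq0//.
  by rewrite mul1r scalerDr addrAC subrr add0r.
have -> : (fun n => mean (x \o k) (iota n.+1 n.+1)) =
          (fun n => 2 *: a n.*2.+1 - a n) by apply/funext.
have -> : l = 2 *: l - l by rewrite scaler_nat mulr2n addrK.
apply: cvgB => //; apply: cvgZl_tmp.
apply/cvg_dist_lt => e /((cvg_dist_lt _ _).1 kl)[N Na]; exists N => n Nn.
by apply: Na; rewrite (leq_trans Nn)// -addnn -addnS leq_addr.
Qed.

Definition archimedean_norm (K : numFieldType) : Prop :=
  forall z : K, exists n : nat, `|z| <= n%:R.

Definition precompact_disc (K : numFieldType) : Prop :=
  forall e : K, 0 < e -> exists L : seq K,
    forall z, `|z| <= 1 -> exists2 w, w \in L & `|z - w| <= e.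

Lemma sorted_ltn_map (k : nat -> nat) s : {homo k : i j / (i < j)%N} ->
  sorted ltn s -> sorted ltn (map k s).
Proof. by move=> kk; exact: homo_sorted. Qed.

Lemma sorted_ltn_cat s s' p : sorted ltn s -> sorted ltn s' ->
  all (fun i => i < p)%N s -> all (leq p) s' -> sorted ltn (s ++ s').
Proof.
rewrite !(sorted_pairwise ltn_trans) pairwise_cat => -> -> /allP sp /allP s'p.
by rewrite !andbT; apply/allrelP => i j /sp ip /s'p; exact: leq_trans.
Qed.

(* A large gap for all blocks of lengths [n.+1] and [2n.+2] is excluded since
   the subsequence given by the Banach-Saks property contains blocks with a small
   gap. *)
Lemma Banach_Saks_dichotomy (K : numFieldType) (E : normedModType K) :
  archimedean_norm K -> Banach_Saks_property E ->
  forall (x : nat -> E) (M : K), (forall n, `|x n| <= M) ->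
  exists2 m : nat -> nat, {homo m : i j / (i < j)%N} &
    forall e, 0 < e -> exists n, forall s s',
      sorted ltn (s ++ s') -> all (leq n) (s ++ s') ->
      size s = n.+1 -> size s' = n.*2.+2 ->
      `|mean (x \o m) s - mean (x \o m) s'| < e.
Proof.
move=> arch BS x M xM.
(* The colour [(n, j)] tests the gap between a block of length [n.+1] and the next one, of length
   [n.*2.+2], against [j.+1%:R^-1]. *)
pose gap (n : nat) s := `|mean x (take n.+1 s) - mean x (drop n.+1 s)|.
have [m mm [b mb]] := diagonal_Ramsey (fun k => (k.1.+1 + k.1.*2.+2)%N)
  (fun k s => k.2.+1%:R^-1 <= gap k.1 s).
exists m => // e e0.
have [j je] : exists j, j.+1%:R^-1 < e :> K.
  have [j ej] := arch e^-1; exists j; rewrite invf_plt ?posrE ?ltr0n//.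
  rewrite ger0_norm ?invr_ge0 ?(ltW e0)// in ej.
  by rewrite (le_lt_trans ej)// ltr_nat.
have [k [kk [l /cvg_dist_lt kl]]] := Banach_Saks_tails BS (fun n => xM (m n)).
have kge := homo_ltn_geq kk.
have j0 : 0 < j.+1%:R^-1 / 2 :> K by rewrite divr_gt0 ?invr_gt0 ?ltr0n.
(* The colour [(n, j)] is homogeneous beyond both [n] and [j]; as [j <= n], indices at least [n]
   qualify. *)
have [N Nkl] := kl _ j0; pose n := maxn j N.
have mean_map z s : mean z (map m s) = mean (z \o m) s.
  by rewrite /mean size_map big_map.
exists n => s s' ss ns sn sn'.
have nb : ~ b (n, j).
  (* The tail blocks of ranks [n] and [n.*2.+1] are adjacent and have the two lengths of the colour;
     both their means are close to [l]. *)
  pose t := map k (iota n.+1 (n.+1 + n.*2.+2)).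
  have nt : all (leq n) t.
    apply/allP => _ /mapP[i + ->]; rewrite mem_iota => /andP[ni _].
    by rewrite (leq_trans _ (kge i))// ltnW.
  have jt : all (leq j) t.
    by apply: sub_all nt => i; apply: leq_trans; exact: leq_maxl.
  have st : sorted ltn t.
    by apply: sorted_ltn_map => //; exact: iota_ltn_sorted.
  have sizet : size t = (n.+1 + n.*2.+2)%N by rewrite size_map size_iota.
  have [_ /[apply]] := mb (n, j) t st nt jt sizet.
  have -> : gap n (map m t) =
      `|mean ((x \o m) \o k) (iota n.+1 n.+1) -
        mean ((x \o m) \o k) (iota n.*2.+2 n.*2.+2)|.
    rewrite /gap /t iotaD !map_cat take_size_cat ?size_map ?size_iota//.
    rewrite drop_size_cat ?size_map ?size_iota// !mean_map.
    have -> : (n.+1 + n.+1 = n.*2.+2)%N by rewrite addnn doubleS.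
    by rewrite /mean !size_map !big_map.
  have nl := Nkl n (leq_maxr j N).
  have ql : `|l - mean ((x \o m) \o k) (iota n.*2.+2 n.*2.+2)| < j.+1%:R^-1 / 2.
    by apply: Nkl; rewrite (leq_trans (leq_maxr j N))// -addnn -addnS leq_addr.
  rewrite [leRHS](_ : _ = `|(l - mean ((x \o m) \o k) (iota n.*2.+2 n.*2.+2)) -
    (l - mean ((x \o m) \o k) (iota n.+1 n.+1))|); last first.
    by rewrite opprB [_ + (_ - l)]addrC addrA addrNK.
  move=> /le_lt_trans/(_ (le_lt_trans (ler_normB _ _) (ltrD ql nl))).
  by rewrite -splitr ltxx.
have := mb (n, j) (s ++ s') ss; rewrite /= size_cat sn sn'.
have nN := sub_all (fun i => leq_trans (leq_maxl j N)) ns.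
move=> /(_ ns nN erefl)[gb _]; apply: lt_trans je.
rewrite /gap map_cat take_size_cat ?size_map// drop_size_cat ?size_map// in gb.
rewrite !mean_map in gb.
by rewrite real_ltNge ?normr_real ?realV ?realn//; apply/negP => /gb.
Qed.

Lemma card_le_sorted (J : set nat) (N : nat) :
  (forall s, sorted ltn s -> (forall i, i \in s -> J i) -> (size s <= N)%N) ->
  (J #<= `I_N)%card.
Proof.
move=> JN; have finN (A : {fset nat}) :
    [set` A] `<=` J -> (size (enum_fset A) <= N)%N.
  move=> AJ; rewrite -(size_sort leq); apply: JN => [|i].
    by rewrite sort_lt_sorted fset_uniq.
  by rewrite mem_sort; exact: AJ.
have [/finite_setP[n Jn]|/(infinite_set_fset N.+1)[A AJ]] :=
  pselect (finite_set J); last first.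
  by move=> /leq_trans/(_ (finN A AJ)); rewrite ltnn.
have finJ : finite_set J by apply/finite_setP; exists n.
rewrite (card_le_eql Jn) card_le_II -(card_fset_set Jn); apply: finN.
by rewrite fset_setK.
Qed.

Lemma pigeonhole_seq (T : Type) (L : seq T) (P : T -> pred nat) (s : seq nat)
    n :
  (forall i, i \in s -> has (fun w => P w i) L) ->
  (size L * n < size s)%N ->
  exists w, (n < size [seq i <- s | P w i])%N.
Proof.
elim: L s => [|w L IH] s sL.
  by case: s sL => // i s /(_ i (mem_head _ _)).
rewrite mulSn => Ls; have [|wn] := ltnP n (size [seq i <- s | P w i]).
  by exists w.
have [i||w' nw'] := IH [seq i <- s | ~~ P w i].
- by rewrite mem_filter => /andP[/negbTE wi /sL /=]; rewrite wi.
- move: Ls; rewrite -(count_predC (P w)) -!size_filter => Ls.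
  by rewrite -(ltn_add2l n) (leq_trans Ls)// leq_add2r.
- exists w'; rewrite (leq_trans nw')// -filter_predI !size_filter.
  by apply: sub_count => j /andP[].
Qed.

(* The functional [phi] is nearly a constant [w] on many terms; by the
   dichotomy its means over all later blocks are then near [w], while the
   Banach-Saks tail means force these to be near [0]. *)
Lemma Banach_Saks_uniformly_weakly_null (K : numFieldType)
    (E : normedModType K) : archimedean_norm K -> precompact_disc K ->
  Banach_Saks_property E ->
  forall (x : nat -> E) (M : K), (forall n, `|x n| <= M) ->
  exists2 m : nat -> nat, {homo m : i j / (i < j)%N} &
    exists l : E, uniformly_weakly_null (fun j => x (m j) - l).
Proof.
move=> arch disc BS x M xM.
have [m mm mP] := Banach_Saks_dichotomy arch BS xM; exists m => //.
have [k [kk [l /cvg_dist_lt kl]]] := Banach_Saks_tails BS (fun n => xM (m n)).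
exists l => e e0; set z := x \o m in mP kl *.
pose B := M + `|l| + 1.
have B0 : 0 < B by rewrite ltr_wpDl// addr_ge0// (le_trans _ (xM 0)).
(* The estimates add up to [|f i| < d * 4], which is below [e]. *)
pose d := e / 8.
have d0 : 0 < d by rewrite divr_gt0.
(* Multiplied by [B], this becomes a net of mesh [d] for the values of [phi] on the [z j - l],
   bounded by [B]. *)
have [L LP] := disc _ (divr_gt0 d0 B0).
have [n nP] := mP d d0.
(* At most [n] indices lie below [n]; more than [size L * n.+1] others would put at least [n.+1]
   values near one point of the net. *)
exists (n + size L * n.+1)%N => phi phi1.
pose f j : K^o := phi (z j - l).
have fB j : `|f j| <= B.
  rewrite (le_trans (dual_norm_leP phi1 _))// mul1r /B ler_wpDr//.
  by rewrite (le_trans (ler_normB _ _))// lerD2r; exact: xM.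
have meanf s : (0 < size s)%N -> mean f s = phi (mean z s - l).
  by move=> s0; rewrite mean_subE// linearZ raddf_sum.
apply: card_le_sorted => s ss sJ; rewrite leqNgt; apply/negP => sN.
pose s1 := [seq i <- s | (n <= i)%N].
have s1N : (size L * n.+1 < size s1)%N.
  rewrite -(ltn_add2l n) (leq_trans sN)// -(count_predC (leq n) s) addnC.
  rewrite -!size_filter leq_add2r -[leqRHS](size_iota 0).
  apply: uniq_leq_size; first exact/filter_uniq/(sorted_uniq ltn_trans ltnn).
  by move=> i; rewrite mem_filter mem_iota /= -ltnNge => /andP[].
have [i|w] := pigeonhole_seq (L := L)
  (P := fun w i => `|f i - B * w| <= d) _ s1N.
  move=> _; have /LP[w wL wi] : `|f i / B| <= 1.
    by rewrite normrM normfV (gtr0_norm B0) ler_pdivrMr// mul1r.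
  apply/hasP; exists w => //.
  rewrite -(divfK (lt0r_neq0 B0) (f i)) mulrC -mulrBr.
  by rewrite normrM (gtr0_norm B0) mulrC -ler_pdivlMr.
set s2 := [seq _ <- _ | _] => s2n; set c := B * w in s2 s2n.
have {}s2n : (n < size s2)%N by exact: ltnW s2n.
pose F := take n.+1 s2.
have sF : size F = n.+1 by rewrite size_takel.
have F_sub i : i \in F -> [/\ e <= `|f i|, (n <= i)%N & `|f i - c| <= d].
  move=> /mem_take; rewrite !mem_filter => /and3P[fc ni /sJ Ji]; split=> //.
have Fs : sorted ltn F.
  apply: take_sorted; do 2!(apply: sorted_filter; first exact: ltn_trans).
  exact: ss.
have [p Fp] : exists p, all (fun i => i < p)%N F.
  exists (\max_(i <- F) i).+1; apply/allP => i iF.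
  by rewrite ltnS (@leq_bigmax_seq _ F xpredT id).
have F0 : (0 < size F)%N by rewrite sF.
have Fc : `|mean f F - c| <= d.
  by apply: mean_dist_le => // i /F_sub[].
(* One [d] comes from the dichotomy between [F] and the later block [s'], the other from [Fc]. *)
have blk s' : sorted ltn s' -> all (leq (maxn n p)) s' -> size s' = n.*2.+2 ->
    `|mean f s' - c| <= d + d.
  move=> ss' ps' ns'; have s'0 : (0 < size s')%N by rewrite ns'.
  have ps'p := sub_all (fun i => leq_trans (leq_maxr n p)) ps'.
  have ps'n := sub_all (fun i => leq_trans (leq_maxl n p)) ps'.
  have nF : all (leq n) F by apply/allP => i /F_sub[].
  have := nP F s' (sorted_ltn_cat Fs ss' Fp ps'p); rewrite all_cat nF ps'n.
  move=> /(_ isT sF ns')/ltW zd.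
  rewrite -[_ - c](subrKA (mean f F)) (le_trans (ler_normD _ _))// lerD//.
  rewrite distrC !meanf// -linearB opprB addrA addrNK.
  by rewrite (le_trans (dual_norm_leP phi1 _))// mul1r.
have [N Nkl] := kl d d0.
(* The length [q.+1] of the tail block of rank [q] is a multiple of [n.*2.+2], so that [blk] applies
   piecewise; [q >= q0] puts the block beyond [F] and its mean within [d] of [l]. *)
pose q0 := maxn (maxn n p) N; pose q := (q0.+1 * n.*2.+2).-1.
have qE : q.+1 = (q0.+1 * n.*2.+2)%N by rewrite prednK// muln_gt0.
have q0q : (q0 <= q)%N by rewrite -ltnS qE -{1}(muln1 q0.+1) leq_mul.
pose t := map k (iota q.+1 q.+1).
have tc : `|mean f t - c| <= d + d.
  apply: (mean_blocks_dist_le (D := n.*2.+2) _ blk (c := q0)) => //.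
  - by apply: sorted_ltn_map => //; exact: iota_ltn_sorted.
  - apply/allP => _ /mapP[i + ->]; rewrite mem_iota => /andP[qi _].
    rewrite (leq_trans _ (homo_ltn_geq kk i))// (leq_trans _ (ltnW qi))//.
    by rewrite (leq_trans _ q0q)// leq_maxl.
  - by rewrite size_map size_iota.
have td : `|mean f t| < d.
  rewrite meanf ?size_map ?size_iota//.
  rewrite (le_lt_trans (dual_norm_leP phi1 _))// mul1r distrC.
  have -> : mean z t = mean (z \o k) (iota q.+1 q.+1).
    by rewrite /mean size_map big_map.
  by apply: Nkl; rewrite (leq_trans _ q0q)// leq_maxr.
have iF : nth 0%N F 0 \in F by exact: mem_nth.
set i := nth 0%N F 0 in iF.
have [Ji _ fic] := F_sub i iF.
have : `|f i| < d * 4.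
  have -> : d * 4 = d + (d + d) + d by ring.
  have -> : f i = (f i - c) + (c - mean f t) + mean f t.
    by rewrite addrA !addrNK.
  rewrite (le_lt_trans (ler_normD _ _))// ler_ltD//.
  by rewrite (le_trans (ler_normD _ _))// lerD// distrC.
move=> /(le_lt_trans Ji); rewrite /d mulrAC ltr_pdivlMr ?ltr0n//.
by rewrite ltr_pM2l// ltr_nat.
Qed.

(** * Finite-dimensional subspaces of the dual *)

Lemma dualD (K : numFieldType) (E : normedModType K) (phi psi : dual E) x :
  (phi + psi) x = phi x + psi x.
Proof. by []. Qed.

Lemma dualZ (K : numFieldType) (E : normedModType K) a (phi : dual E) x :
  (a *: phi) x = a * phi x.
Proof. by []. Qed.

Lemma dualN (K : numFieldType) (E : normedModType K) (phi : dual E) x :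
  (- phi) x = - phi x.
Proof. by []. Qed.

Lemma dual_mulZ (K : numFieldType) (E : normedModType K) (phi : dual E) a x :
  phi (a *: x) = a * phi x.
Proof. exact: linearZ. Qed.

Lemma dual_sub (K : numFieldType) (E : normedModType K) (phi : dual E) x y :
  phi (x - y) = phi x - phi y.
Proof. exact: linearB. Qed.

Lemma dual_bundle (K : numFieldType) (E : normedModType K) (c : K)
    (f : {linear E -> K^o}) : 0 <= c ->
  (forall x, `|f x| <= c * `|x|) -> exists phi : dual E, phi = f :> (E -> K^o).
Proof.
move=> c0 fc; have fcont : (f : E -> K^o) \in @continuous_functional K E.
  apply/asboolP; split; first exact: linearP.
  apply: bounded_linear_continuous; exists c; split; first exact: ger0_real.
  move=> M cM; apply/nbhs_ballP; exists 1 => //= x.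
  rewrite -ball_normE /= sub0r normrN => /ltW x1.
  by rewrite (le_trans (fc x))// (le_trans _ (ltW cM))// ler_piMr.
by exists (Dual fcont).
Qed.

Lemma dual_bounded (K : numFieldType) (E : normedModType K) (phi : dual E) :
  exists c, dual_norm_le phi c.
Proof.
have : bounded_near phi (nbhs (0 : E)).
  apply/linear_bounded_continuous.
  by case: phi => f /= /asboolP[].
move=> [M [Mreal MP]].
have /MP/nbhs_ballP[r /= r0 rM] : M < `|M| + 1.
  by rewrite ltr_pwDr// real_ler_norm.
have r20 : 0 < r / 2 by rewrite divr_gt0.
exists ((`|M| + 1) / (r / 2)) => x x1; rewrite ler_pdivlMr// mulrC.
rewrite -{1}(gtr0_norm r20) -normrM -[_ * _]/((r / 2) *: (phi x : K^o)).
rewrite -linearZ.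
apply: rM; rewrite -ball_normE /= sub0r normrN normrZ (gtr0_norm r20).
rewrite (le_lt_trans (ler_piMr (ltW r20) x1))// ltr_pdivrMr//.
by rewrite ltr_pMr// ltr1n.
Qed.

Section span.
Variables (K : fieldType) (V : lmodType K).

(** Peeling off one generator at a time suits inductions on the list. *)
Fixpoint in_span (S : seq V) (v : V) : Prop :=
  if S is s :: S' then exists a, in_span S' (v - a *: s) else v = 0.

Lemma in_spanZ S c v : in_span S v -> in_span S (c *: v).
Proof.
elim: S v => [|s S IH] v /=; first by move=> ->; rewrite scaler0.
by move=> [a /IH]; rewrite scalerBr scalerA; exists (c * a).
Qed.

Lemma in_span_sum S (a : nat -> K) :
  in_span S (\sum_(i < size S) a i *: nth 0 S i).
Proof.
elim: S a => [|s S IH] a /=; first by rewrite big_ord0.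
by exists (a 0%N); rewrite big_ord_recl /= addrC addKr; exact: IH (a \o succn).
Qed.

Lemma in_spanP S v : in_span S v ->
  exists a : nat -> K, v = \sum_(i < size S) a i *: nth 0 S i.
Proof.
elim: S v => [|s S IH] v /=; first by move=> ->; exists 0; rewrite big_ord0.
move=> [c /IH[a va]]; exists (fun i => if i is j.+1 then a j else c).
by rewrite big_ord_recl /= -va addrC subrK.
Qed.

End span.

Lemma dual_in_span0 (K : numFieldType) (E : normedModType K) (phi : dual E)
    S v :
  (forall s, s \in S -> phi s = 0) -> in_span S v -> phi v = 0.
Proof.
move=> phi0 /in_spanP[a ->]; rewrite raddf_sum big1// => i _.
by rewrite [LHS]dual_mulZ phi0 ?mulr0// mem_nth.
Qed.

Lemma infinite_dimensional_span (K : numFieldType) (E : normedModType K) :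
  ~ finite_dimensional E -> forall S : seq E, exists x, ~ in_span S x.
Proof.
move=> infE S; apply/not_existsP => spanS; apply: infE.
exists (size S), (fun i => nth 0 S i) => x.
have /contrapT/in_spanP[a xa] := spanS x.
by exists (fun i => a i).
Qed.

(** Hahn-Banach is applied only along the line of a single vector. When [s] is outside the span of
    [S], a functional [phis] with [phis s = 1] corrects the one obtained for [x - phis x *: s]. *)
Lemma dual_annihilator (K : numFieldType) (E : normedModType K) :
  Hahn_Banach_field K -> forall (S : seq E) x, ~ in_span S x ->
  exists phi : dual E, (forall s, s \in S -> phi s = 0) /\ phi x = 1.
Proof.
move=> HB; elim=> [|s S IH] x xS.
  have nx0 : `|x| != 0 by rewrite normr_eq0; apply/eqP.
  have [||u|g [gE gx]] := HB K^o E (scaler_line x)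
    (scaler_line (`|x| : K^o)) (fun v : E => `|v|).
  - exact: ler_normD.
  - exact: normrZ.
  - by rewrite /= /scaler_line !normrZ normr_id.
  have [v|phi phiE] := dual_bundle (f := g) ler01; first by rewrite mul1r.
  exists (`|x|^-1 *: phi); split=> //; rewrite dualZ phiE.
  have := gx 1; rewrite /= /scaler_line scale1r => ->.
  by rewrite scale1r mulVf.
have [sS|sS] := pselect (in_span S s).
  have [|phi [phiS phix]] := IH x.
    by apply: contra_not xS => xS; exists 0; rewrite scale0r subr0.
  exists phi; split=> // t; rewrite inE => /predU1P[->|]; last exact: phiS.
  exact: dual_in_span0 sS.
have [phis [phisS phiss]] := IH s sS.
have [|phi [phiS phix]] := IH (x - phis x *: s).
  by apply: contra_not xS => xS; exists (phis x).
exists (phi - phi s *: phis); split=> [t|].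
  rewrite dualD dualN dualZ inE => /predU1P[->|tS].
    by rewrite phiss mulr1 subrr.
  by rewrite phiS// phisS// mulr0 subr0.
by rewrite dualD dualN dualZ -phix dual_sub dual_mulZ mulrC.
Qed.

Section norming.
Variables (K : numFieldType) (E : normedModType K).
Hypotheses (arch : archimedean_norm K) (disc : precompact_disc K).
Implicit Types (W : seq (dual E)) (S : seq E) (h psi : dual E).

Definition precompact_span W : Prop := forall e : K, 0 < e ->
  exists L : seq (dual E), forall h, in_span W h -> dual_norm_le h 1 ->
    exists2 g, g \in L & dual_norm_le (h - g) e.

(* The constant 8 is arbitrary; what matters is that it works for all [W]. *)
Definition norming W S : Prop := forall h, in_span W h ->
  (forall s, s \in S -> `|h s| <= 8^-1) -> dual_norm_le h 1.

(** A substitute for normalization that avoids the dual norm as a number: [h] is divided by the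
    least power of 2 that bounds it. *)
Lemma dual_rescale h : ~ dual_norm_le h 1 ->
  exists c : K, [/\ 0 < c, c <= 1, dual_norm_le (c *: h) 1 &
    exists2 x, `|x| <= 1 & 2^-1 < `|(c *: h) x|].
Proof.
move=> h1; have [c hc] := dual_bounded h; have [n cn] := arch c.
have hn : exists n, `[< dual_norm_le h (2 ^+ n) >].
  exists n; apply/asboolP => x /hc hx; rewrite (le_trans hx)//.
  have c0 : 0 <= c by rewrite (le_trans _ hx).
  rewrite -(ger0_norm c0) (le_trans cn)//.
  by rewrite -natrX ler_nat ltnW// ltn_expl.
case: (ex_minnP hn) => -[|k] /asboolP hk kmin; first by rewrite expr0 in hk.
have h2 : (0 : K) < 2 ^+ k.+1 by rewrite exprn_gt0.
exists (2 ^+ k.+1)^-1; split.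
- by rewrite invr_gt0.
- by rewrite invf_le1// exprn_ege1// ler1n.
- move=> x /hk; rewrite dualZ normrM normfV (gtr0_norm h2).
  by rewrite mulrC ler_pdivrMr// mul1r.
- have /asboolPn/existsNP[x] : ~~ `[< dual_norm_le h (2 ^+ k) >].
    by apply/negP => /kmin; rewrite ltnn.
  move=> /not_implyP[x1 hx]; exists x => //.
  rewrite dualZ normrM normfV (gtr0_norm h2) mulrC ltr_pdivlMr//.
  rewrite exprS mulKf ?pnatr_eq0//.
  by rewrite real_ltNge ?realX ?normr_real ?realn//; apply/negP.
Qed.

(** Each [g] in a net of mesh 1/8 receives a point of the ball where it exceeds 3/8, if there is
    one. If [h] had norm above 1, a rescaled [h] exceeding 1/2 somewhere would be close to such a
    [g], yet [g] would be at most 2/8 at its point. *)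
Lemma norming_of_precompact W : precompact_span W ->
  exists2 S0 : seq E, (forall s, s \in S0 -> `|s| <= 1) &
    forall S, {subset S0 <= S} -> norming W S.
Proof.
move=> precW; have u0 : 0 < 8^-1 :> K by rewrite invr_gt0.
have [L LP] := precW _ u0.
have pick (g : dual E) : exists s : E, `|s| <= 1 /\
    ((exists2 x, `|x| <= 1 & 8^-1 *+ 3 < `|g x|) -> 8^-1 *+ 3 < `|g s|).
  have [[x x1 gx]|nx] := lem (exists2 x, `|x| <= 1 & 8^-1 *+ 3 < `|g x|).
    by exists x.
  by exists 0; rewrite normr0; split.
have [pk pkP] := choice pick.
exists (map pk L) => [_ /mapP[g _ ->]|S S0S h Wh hS]; first by case: (pkP g).
apply: contrapT => /dual_rescale[c [c0 c1 ch1 [x x1 cx]]].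
have [g gL hg] := LP _ (in_spanZ c Wh) ch1.
have [p1 gp] := pkP g.
have {}gp : 8^-1 *+ 3 < `|g (pk g)|.
  apply: gp; exists x => //.
  rewrite -(ltrD2r 8^-1) -mulrSr (_ : 8^-1 *+ 4 = 2^-1 :> K); last first.
    by field.
  apply: (lt_le_trans cx); rewrite -lerBlDl.
  rewrite (le_trans _ (hg x x1))// dualD dualN.
  by apply: le_trans (lerB_dist _ _).
have pS : pk g \in S by apply/S0S/map_f.
have hp : `|(c *: h) (pk g)| <= 8^-1.
  rewrite dualZ normrM (gtr0_norm c0) (le_trans _ (hS _ pS))//.
  by rewrite ler_piMl.
have : `|g (pk g)| <= 8^-1 *+ 2.
  rewrite -[g _](subrK ((c *: h) (pk g))) mulr2n (le_trans (ler_normD _ _))//.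
  by rewrite lerD// distrC; exact: hg.
move=> /(lt_le_trans gp); rewrite (ltr_pMn2l u0)//.
Qed.

(* Since [psi] vanishes on [S], the component in [span W] of an element of
   [span (psi :: W)] is controlled by its values on [S]. *)
Lemma precompact_span_cons W S psi x : norming W S -> precompact_span W ->
  (forall s, s \in S -> `|s| <= 1) -> (forall s, s \in S -> psi s = 0) ->
  dual_norm_le psi 1 -> `|x| <= 1 -> 2^-1 <= `|psi x| ->
  precompact_span (psi :: W).
Proof.
move=> NW PW S1 psiS psi1 x1 psix e e0.
(* With [h = a *: psi + w], norming bounds [w] by 8, and at [x] this gives [|a| * 2^-1 <= 1 + 8], so
   [|a| <= 18]. The meshes make each part contribute [e / 2]. *)
have [Lw LwP] : exists L : seq (dual E), forall h, in_span W h ->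
    dual_norm_le h 1 -> exists2 g, g \in L & dual_norm_le (h - g) (e / 16).
  by apply: PW; rewrite divr_gt0.
have [La LaP] : exists L : seq K, forall z, `|z| <= 1 ->
    exists2 w, w \in L & `|z - w| <= e / 36.
  by apply: disc; rewrite divr_gt0.
exists (allpairs (fun a g => (18 * a) *: psi + 8 *: g) La Lw) => h [a Wh] h1.
set w := h - a *: psi in Wh.
have ws s : s \in S -> w s = h s.
  by move=> sS; rewrite /w dualD dualN dualZ psiS// mulr0 subr0.
have w8 : dual_norm_le (8^-1 *: w) 1.
  apply: NW; first exact: in_spanZ.
  move=> s sS; rewrite dualZ normrM ws// ger0_norm ?invr_ge0 ?ler0n//.
  by rewrite ler_piMr ?invr_ge0 ?ler0n// h1// S1.
have a18 : `|a / 18| <= 1.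
  rewrite normrM normfV normr_nat ler_pdivrMr ?ltr0n// mul1r.
  have wx : `|w x| <= 8.
    have := w8 x x1; rewrite dualZ normrM normfV normr_nat mulrC.
    by rewrite ler_pdivrMr ?ltr0n// mul1r.
  have : `|a| * `|psi x| <= 9.
    rewrite -normrM (_ : a * psi x = h x - w x); last first.
      by rewrite /w dualD dualN dualZ opprB addrC subrK.
    rewrite (le_trans (ler_normB _ _))// (_ : 9 = 1 + 8 :> K)//.
    by rewrite lerD// h1.
  move=> apsi; have : `|a| * 2^-1 <= 9.
    by rewrite (le_trans _ apsi)// ler_wpM2l.
  rewrite ler_pdivrMr ?ltr0n// => /le_trans; apply.
  by rewrite -natrM.
have [g gL wg] := LwP _ (in_spanZ 8^-1 Wh) w8.
have [b bL ab] := LaP _ a18.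
exists ((18 * b) *: psi + 8 *: g); first exact: allpairs_f.
move=> y y1.
have -> : (h - ((18 * b) *: psi + 8 *: g)) y =
    18 * (a / 18 - b) * psi y + 8 * (8^-1 *: w - g) y.
  rewrite !(dualD, dualN, dualZ) /w; by field.
rewrite (le_trans (ler_normD _ _))//.
rewrite (_ : e = 18 * (e / 36) + 8 * (e / 16)); last by field.
rewrite lerD// !normrM !normr_nat; last first.
  by rewrite ler_wpM2l ?ler0n//; exact: wg.
by rewrite -mulrA ler_wpM2l ?ler0n// -[leRHS]mulr1 ler_pM// psi1.
Qed.

End norming.

(* Finite-dimensional duality: the Hahn-Banach extension to the sup-normed
   space of functions on [S] has the coefficients of [x] as its coordinates. *)
Lemma Helly_span (K : numFieldType) (E : normedModType K) :
  Hahn_Banach_field K -> forall (W : seq (dual E)) (S : seq E)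
    (F : {linear dual E -> K^o}) (C : K), 0 <= C ->
  (forall s, s \in S -> `|s| <= 1) ->
  (forall h d, in_span W h -> 0 <= d -> (forall s, s \in S -> `|h s| <= d) ->
    `|F h| <= C * d) ->
  exists x, [/\ `|x| <= C,
    forall phi : dual E, (forall s, s \in S -> phi s = 0) -> phi x = 0 &
    forall psi, psi \in W -> psi x = F psi].
Proof.
move=> HB W S F C C0 S1 FW.
pose comb (a : 'rV[K]_(size W)) : dual E := \sum_i a 0 i *: nth 0 W i.
have comblin : linear comb.
  move=> c a b; rewrite /comb scaler_sumr -big_split; apply: eq_bigr => i _ /=.
  by rewrite !mxE scalerDl scalerA.
pose eval (a : 'rV[K]_(size W)) : 'rV[K]_(size S) :=
  \row_j comb a (nth 0 S j).
have evallin : linear eval.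
  by move=> c a b; apply/rowP => j; rewrite !mxE comblin.
have Flin : linear (F \o comb : 'rV[K]_(size W) -> K^o).
  by move=> c a b; rewrite /= comblin linearP.
have [T TE] := linear_bundle evallin.
have [f fE] := linear_bundle Flin.
have comb_span a : in_span W (comb a).
  have := in_span_sum W (fun i => if insub i is Some j then a 0 j else 0).
  congr in_span; apply: eq_bigr => i _; by rewrite valK.
have norm_coord n (v : 'rV[K]_n) j : `|v 0 j| <= `|v|.
  rewrite -[leRHS]/(mx_norm v) mx_normE -[leLHS]nngE num_le.
  exact: (le_bigmax _ (fun i : 'I_1 * 'I_n => `|v i.1 i.2|%:nng) (0, j)).
have [||a|g [gC gT]] := HB _ _ T f (fun v => C * `|v|).
- by move=> v w; rewrite -mulrDr ler_wpM2l// ler_normD.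
- by move=> c v; rewrite normrZ mulrCA.
- rewrite fE TE; apply: FW => // s /(nthP 0)[j jS <-].
  have := norm_coord _ (eval a) (Ordinal jS).
  by rewrite mxE.
pose c j : K := g (delta_mx 0 j).
have gE v : g v = \sum_j v 0 j * c j.
  rewrite {1}(row_sum_delta v) raddf_sum; apply: eq_bigr => j _.
  by rewrite [LHS]linearZ.
exists (\sum_j c j *: nth 0 S j); split.
- rewrite (le_trans (ler_norm_sum _ _ _))//.
  (* On this vector of conjugate phases [g] takes the value [\sum_j |c j|], which is therefore at
     most [C]. *)
  pose v : 'rV[K]_(size S) := \row_j (if c j == 0 then 0 else `|c j| / c j).
  have v1 : `|v| <= 1.
    rewrite -[leLHS]/(mx_norm v).
    have [->|/mx_norm_neq0[i vi]] := eqVneq (mx_norm v) 0; first exact: ler01.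
    rewrite vi mxE; have [_|cj] := eqVneq; first by rewrite normr0.
    by rewrite normrM normr_id normfV mulfV// normr_eq0.
  have : `|g v| <= C by rewrite (le_trans (gC v))// ler_piMr.
  have -> : g v = \sum_j `|c j|.
    rewrite gE; apply: eq_bigr => j _; rewrite mxE.
    by have [->|cj] := eqVneq; rewrite ?mul0r ?normr0// divfK.
  rewrite ger0_norm ?sumr_ge0// => /(le_trans _); apply; apply: ler_sum => j _.
  by rewrite normrZ ler_piMr// S1// mem_nth.
- move=> phi phi0; rewrite raddf_sum big1// => j _.
  by rewrite [LHS]dual_mulZ phi0 ?mulr0// mem_nth.
- move=> psi /(nthP 0)[i iW <-].
  have combi : comb (delta_mx 0 (Ordinal iW)) = nth 0 W i.
    rewrite /comb (bigD1 (Ordinal iW))//= big1 ?addr0.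
      by rewrite mxE !eqxx scale1r.
    by move=> k ki; rewrite mxE eqxx (negbTE ki) scale0r.
  have := gT (delta_mx 0 (Ordinal iW)); rewrite fE /= combi => <-.
  rewrite TE gE raddf_sum; apply: eq_bigr => j _.
  by rewrite [LHS]dual_mulZ mxE combi mulrC.
Qed.

(** * Weakly null sequences of functionals *)

Section weakly_null_sequence.
Variables (K : numFieldType) (E : normedModType K).
Hypotheses (HB : Hahn_Banach_field K) (arch : archimedean_norm K).
Hypotheses (disc : precompact_disc K) (infE : ~ finite_dimensional E).

Definition norming_pair (st : seq (dual E) * seq E) : Prop :=
  [/\ forall s, s \in st.2 -> `|s| <= 1, norming st.1 st.2 &
      precompact_span st.1].

Definition norming_extension (st : seq (dual E) * seq E)
    (t : dual E * seq E) : Prop :=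
  [/\ {subset st.2 <= t.2}, dual_norm_le t.1 1,
      forall s, s \in st.2 -> t.1 s = 0 &
      exists2 x, `|x| <= 1 & 2^-1 <= `|t.1 x|].

(** The new functional is a rescaled annihilator of [S]; it keeps the span precompact, so finitely
    many further points norm the larger span. *)
Lemma norming_pair_extend st : norming_pair st ->
  exists t, norming_pair (t.1 :: st.1, t.2) /\ norming_extension st t.
Proof.
move: st => [W S] [/= S1 NW PW].
have [x0 x0S] := infinite_dimensional_span infE S.
have [phi [phiS phix0]] := dual_annihilator HB x0S.
have nx0 : `|x0| != 0.
  rewrite normr_eq0; apply: contra_eq_neq phix0 => ->.
  by rewrite linear0 eq_sym oner_neq0.
(* This factor gives [h] the value 2 at the normalized [x0], so that [dual_rescale] applies. *)
pose h := (2 * `|x0|) *: phi.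
have /(dual_rescale arch)[c [c0 c1 ch1 [x x1 cx]]] : ~ dual_norm_le h 1.
  move=> /(_ (`|x0|^-1 *: x0)); rewrite normrZ normfV normr_id mulVf//.
  move=> /(_ (lexx _)); rewrite dualZ dual_mulZ phix0 mulr1 -mulrA mulfV//.
  by rewrite mulr1 normr_nat (ler_nat K 2 1).
pose psi := c *: h.
have psiS s : s \in S -> psi s = 0.
  by move=> sS; rewrite !dualZ phiS// !mulr0.
have PW' := precompact_span_cons disc NW PW S1 psiS ch1 x1 (ltW cx).
have [S0 S01 S0N] := norming_of_precompact arch PW'.
exists (psi, S0 ++ S); split; split=> //=.
- by move=> s; rewrite mem_cat => /orP[/S01|/S1].
- by apply: S0N => s; rewrite mem_cat => ->.
- by move=> s; rewrite mem_cat orbC => ->.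
- by exists x => //; exact: ltW.
Qed.

Lemma norming_sequence : exists (psi : nat -> dual E) (W : nat -> seq (dual E))
    (S : nat -> seq E),
  [/\ forall n, norming_pair (W n, S n),
      forall n, W n.+1 = psi n :: W n &
      forall n, norming_extension (W n, S n) (psi n, S n.+1)].
Proof.
have next st : exists t, norming_pair st ->
    norming_pair (t.1 :: st.1, t.2) /\ norming_extension st t.
  have [/norming_pair_extend[t]|nst] := lem (norming_pair st).
    by exists t.
  by exists (0, [::]).
have [nx nxP] := choice next.
pose step st := ((nx st).1 :: st.1, (nx st).2).
pose st n := iter n step ([::], [::]).
have stP n : norming_pair (st n).
  elim: n => [|n IH]; last by have [] := nxP _ IH.
  split=> //= [h|e e0].
    by move=> /= -> _ x _; rewrite normr0 ler01.
  exists [:: 0] => h /= -> _; exists 0; first exact: mem_head.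
  by move=> x _; rewrite subr0 normr0 ltW.
exists (fun n => (nx (st n)).1), (fun n => (st n).1), (fun n => (st n).2).
split=> [n|//|n]; first by case: (st n) (stP n).
by have [_ st_ext] := nxP _ (stP n); exact: st_ext.
Qed.

(* Every functional [F] on the dual is represented on all the [psi i] by a
   single point [l], a limit of means of points of the spans of the [S n]; the
   [psi i] tend to [0] on these spans, hence at [l]. *)
Lemma exists_weakly_null : Banach_Saks_property E ->
  exists (psi : nat -> dual E) (x : nat -> E),
    [/\ dual_weakly_null psi, forall n, `|x n| <= 1 &
        forall n, 2^-1 <= `|psi n (x n)|].
Proof.
move=> BS; have [psi [W [S [WS WE ext]]]] := norming_sequence.
have /choice[x xP] : forall n, exists x, `|x| <= 1 /\ 2^-1 <= `|psi n x|.
  by move=> n; have [_ _ _ [x x1 px]] := ext n; exists x.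
exists psi, x; split=> [F [M FM]|n|n]; try by case: (xP n).
have M0 : 0 <= M.
  have := FM 0; rewrite linear0 normr0; apply=> y _.
  by rewrite normr0 ler01.
have C0 : 0 <= 8 * M by rewrite mulr_ge0.
have Smono : {homo S : m n / (m <= n)%N >-> {subset m <= n}}.
  apply: homo_leq => [s //|s t u st tu y /st/tu//|n].
  by have [] := ext n.
have psi_W i n : (i < n)%N -> psi i \in W n.
  elim: n => // n IH; rewrite ltnS leq_eqVlt WE inE => /predU1P[->|/IH ->].
    by rewrite eqxx.
  by rewrite orbT.
have /choice[y yP] : forall n, exists y, [/\ `|y| <= 8 * M,
    forall phi : dual E, (forall s, s \in S n -> phi s = 0) -> phi y = 0 &
    forall phi, phi \in W n -> phi y = F phi].
  move=> n; have [/= S1 NW _] := WS n; apply: Helly_span => // h d Wh d0 hd.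
  (* For [d = 0] norming applies to all multiples of [h]; if [F h] were nonzero, [F] would have
     modulus [M + 1] at one of them. *)
  move: d0; rewrite le_eqVlt => /predU1P[d0|d0].
    rewrite -d0 mulr0 normr_le0; apply: contrapT => /negP Fh.
    have nFh : 0 < `|F h| by rewrite normr_gt0.
    have /FM : dual_norm_le (((M + 1) / `|F h|) *: h) 1.
      apply: NW; first exact: in_spanZ.
      move=> s /hd; rewrite -d0 normr_le0 dualZ => /eqP ->.
      by rewrite mulr0 normr0 invr_ge0.
    rewrite linearZ normrZ ger0_norm; last by rewrite divr_ge0 ?addr_ge0// ltW.
    by rewrite divfK ?gt_eqF// gerDl ler10.
  have /FM : dual_norm_le ((8 * d)^-1 *: h) 1.
    apply: NW; first exact: in_spanZ.
    move=> s /hd hs; rewrite dualZ normrM.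
    rewrite ger0_norm ?invr_ge0 ?mulr_ge0 ?(ltW d0)// invfM -mulrA.
    by rewrite ler_piMr ?invr_ge0 ?ler0n// mulrC ler_pdivrMr// mul1r.
  rewrite linearZ normrZ ger0_norm ?invr_ge0 ?mulr_ge0 ?(ltW d0)//.
  by rewrite mulrC ler_pdivrMr ?mulr_gt0// mulrCA mulrA.
have [k [kk [l /cvg_dist_lt kl]]] :=
  Banach_Saks_tails BS (fun n => let: And3 h _ _ := yP n in h).
have kge := homo_ltn_geq kk.
have psi1 n : dual_norm_le (psi n) 1 by have [_ ? _ _] := ext n.
(* For [j > i], [psi i] is in [W (k j)] and takes the value [F (psi i)] at [y (k j)], hence at late
   tail means and at their limit [l]. *)
have psi_l i : psi i l = F (psi i).
  apply/eqP; rewrite -subr_eq0 -normr_le0; apply: contrapT => /negP.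
  rewrite -real_ltNge ?normr_real ?real0// => /kl[N Nkl].
  have := Nkl (maxn N i) (leq_maxl N i); set t := mean _ _ => tl.
  have psit : psi i t = F (psi i).
    rewrite linear_mean; apply/eqP; rewrite -subr_eq0 -normr_le0.
    apply: mean_dist_le; rewrite ?size_iota// => j.
    rewrite mem_iota => /andP[ij _].
    have [_ _ yF] := yP (k j); rewrite /= yF ?subrr ?normr0//.
    apply: psi_W; rewrite (leq_ltn_trans (leq_maxr N i))// (leq_trans ij)//.
  have := dual_norm_leP (psi1 i) (l - t); rewrite mul1r dual_sub psit.
  by move=> /le_lt_trans/(_ tl); rewrite ltxx.
apply/cvg_dist_lt => e e0; have [N Nkl] := kl e e0.
(* The tail block of rank [N] ends at index [N + N.+1], so each [S (k j)] involved is contained in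
   [S n], where [psi n] vanishes. *)
exists (k (N + N.+1)%N) => n Nn.
set t := mean (y \o k) (iota N.+1 N.+1).
have psit : psi n t = 0.
  rewrite linear_mean; apply/eqP; rewrite -normr_le0 -[mean _ _]subr0.
  apply: mean_dist_le; rewrite ?size_iota// => j.
  rewrite mem_iota => /andP[_ jN].
  have [_ phi0 _] := yP (k j); rewrite /= phi0 ?subr0 ?normr0// => s sk.
  have [_ _ psiS _] := ext n; apply: psiS; apply: Smono sk => /=.
  rewrite (leq_trans _ Nn)//.
  have := ltnW_homo kk; apply.
  by rewrite -ltnS -addSn.
have := dual_norm_leP (psi1 n) (l - t); rewrite mul1r dual_sub psit subr0 psi_l.
by rewrite sub0r normrN => /le_lt_trans; apply; exact: Nkl.
Qed.

End weakly_null_sequence.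

(** * The theorem over an abstract field of scalars *)

Lemma Banach_Saks_weak_Dunford_Pettis (K : numFieldType)
    (E : normedModType K) :
  Hahn_Banach_field K -> archimedean_norm K -> precompact_disc K ->
  Banach_Saks_property E -> weak_Dunford_Pettis E -> finite_dimensional E.
Proof.
move=> HB arch disc BS wDP; apply: contrapT => infE.
have [psi [x [psi0 x1 psix]]] := exists_weakly_null HB arch disc infE BS.
have [m mm [l ml]] := Banach_Saks_uniformly_weakly_null arch disc BS x1.
have psim0 : dual_weakly_null (psi \o m).
  move=> F FE; apply/cvg_dist_lt => e e0.
  have [N NP] := (cvg_dist_lt _ _).1 (psi0 F FE) e e0.
  by exists N => n Nn; apply: NP; rewrite (leq_trans Nn)// homo_ltn_geq.
(* Evaluation at [l] is in the bidual, so the translation by [l] costs only a term tending to 0. *)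
have ev_lin : linear (fun phi : dual E => phi l : K^o) by move=> a phi chi.
have [ev evE] := linear_bundle ev_lin.
have psil : (psi \o m) n l @[n --> \oo] --> (0 : K^o).
  have := psim0 ev; rewrite evE; apply; exists `|l| => phi phi1.
  by rewrite evE (le_trans (dual_norm_leP phi1 l))// mul1r.
(* The sum is [psi (m n) (x (m n))], of modulus at least 1/2. *)
have : psi (m n) (x (m n) - l) + psi (m n) l @[n --> \oo] --> (0 : K^o).
  by rewrite -[0 : K^o]addr0; exact: cvgD (wDP _ _ ml psim0) psil.
move=> /(cvg_dist_lt _ _).1/(_ 2^-1)[|N /(_ N (leqnn N))].
  by rewrite invr_gt0.
rewrite sub0r normrN dual_sub subrK => /(le_lt_trans (psix _)).
by rewrite ltxx.
Qed.

(** * Real and complex scalars *)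

Section scalars.
Variable R : realType.

Lemma archimedean_norm_real : archimedean_norm R.
Proof. by move=> z; exists (Num.bound `|z|); rewrite ltW// archi_boundP. Qed.

Lemma precompact_disc_real : precompact_disc R.
Proof.
move=> e e0; have [N eN] := archimedean_norm_real (2 / e).
(* A grid of mesh [e] from -1, reaching 1 since [2 / e <= N]. *)
exists [seq k%:R * e - 1 | k <- iota 0 N.+1] => z.
rewrite ler_norml => /andP[z1 z2].
have z0 : 0 <= (z + 1) / e by rewrite divr_ge0 ?(ltW e0)//; lra.
have /andP[k1 k2] := truncn_itv z0; set k := Num.truncn _ in k1 k2.
exists (k%:R * e - 1).
  apply/mapP; exists k => //; rewrite mem_iota leq0n add0n ltnS.
  rewrite -(ler_nat R) (le_trans k1)//.
  rewrite (le_trans _ eN)// (le_trans _ (ler_norm _))// ler_pM2r ?invr_gt0//.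
  lra.
move: k1 k2; rewrite ler_pdivlMr// ltr_pdivrMr// -natr1 mulrDl mul1r => k1 k2.
rewrite ler_norml; apply/andP; split; lra.
Qed.

Local Open Scope complex_scope.

Lemma archimedean_norm_complex : archimedean_norm R[i].
Proof.
move=> z; have [n zn] := archimedean_norm_real (complex.Re `|z|).
exists n; rewrite normc_def in zn *.
have -> : n%:R = (n%:R : R)%:C by rewrite rmorph_nat.
by rewrite lecR (le_trans (ler_norm _)).
Qed.

(** The product of two real nets of half the mesh. *)
Lemma precompact_disc_complex : precompact_disc R[i].
Proof.
move=> e e0; have eE : e = (complex.Re e)%:C.
  move: e0; rewrite ltcE => /andP[/eqP ei _].
  by apply/eqP; rewrite eq_complex /= ei !eqxx.
have r0 : 0 < complex.Re e / 2.
  by move: e0; rewrite eE ltcR => ?; rewrite divr_gt0.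
have [L LP] := precompact_disc_real r0.
exists [seq a +i* b | a <- L, b <- L] => -[x y].
rewrite normc_def /= (_ : 1 = 1%:C)// lecR => xy1.
have [a aL xa] : exists2 a, a \in L & `|x - a| <= complex.Re e / 2.
  apply: LP; rewrite (le_trans _ xy1)// -sqrtr_sqr ler_wsqrtr// lerDl sqr_ge0//.
have [b bL yb] : exists2 b, b \in L & `|y - b| <= complex.Re e / 2.
  apply: LP; rewrite (le_trans _ xy1)// -sqrtr_sqr ler_wsqrtr// lerDr sqr_ge0//.
exists (a +i* b); first exact: allpairs_f.
rewrite normc_def /= eE lecR.
have e'0 : 0 <= complex.Re e.
  by rewrite ltW// -(pmulr_lgt0 _ (x := 2^-1)) ?invr_gt0.
rewrite -(ger0_norm e'0) -sqrtr_sqr ler_wsqrtr//.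
rewrite -(real_normK (num_real (x - a))) -(real_normK (num_real (y - b))).
have := normr_ge0 (x - a); have := normr_ge0 (y - b); nra.
Qed.

End scalars.

Unset Implicit Arguments.

Theorem corollary4 (R : realType) :
  (forall E : completeNormedModType R,
     Banach_Saks_property E -> weak_Dunford_Pettis E ->
     finite_dimensional E)
  /\
  (forall E : completeNormedModType R[i],
     Banach_Saks_property E -> weak_Dunford_Pettis E ->
     finite_dimensional E).
Proof.
split=> E; apply: Banach_Saks_weak_Dunford_Pettis.
- exact: Hahn_Banach_real.
- exact: archimedean_norm_real.
- exact: precompact_disc_real.
- exact: Hahn_Banach_complex.
- exact: archimedean_norm_complex.
- exact: precompact_disc_complex.
Qed.
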